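(* The Polish Algorithm for left distributivity $abc{*}{*} = ab{*}ac{*}{*}$ (that is, $a(bc)=(ab)(ac)$) terminates for every pair of terms $u, v \in \mathbf{T}$ with $\mathrm{depth}(u) \le 8$ and $\mathrm{depth}(v)\le 8$.
   Context: Terms. $\mathbf{T}$ is the set of terms in one variable $x$ and one binary operation symbol $*$ in right Polish notation: it is the smallest set of finite words over the alphabet $\{x,*\}$ with $x \in \mathbf{T}$ and $st* \in \mathbf{T}$ whenever $s,t\in\mathbf{T}$ (the word $st*$ represents the product $s\cdot t$). The depth of a term is its number of occurrences of $x$. A term $v$ is viewed as a word $v(0)v(1)\cdots v(n-1)$ with $n=\mathrm{length}(v)$. First difference. For $u,v\in\mathbf{T}$, $d(u,v)$ is the least $i<\min(\mathrm{length}(u),\mathrm{length}(v))$ with $u(i)\ne v(i)$ if such an $i$ exists, and $d(u,v)=\infty$ otherwise. Dynamic range. Let $d=d(u,v)<\infty$ and $v(d)=*$ (so $u(d)=x$). Then $u$ and $v$ can be written uniquely as $$u = A\,u_0\,u_1\,u_2 * u_3 * \cdots u_n * *\, B,\qquad v = A\,u_0\,u_1 *\, C,$$ where $n\ge 2$, $u_0,\dots,u_n\in\mathbf{T}$, $A,B,C$ are strings, and the first letter of $u_2$ is at position $d$ in $u$ (so the displayed subterm of $u$ is $u_0\cdot((\cdots((u_1\cdot u_2)\cdot u_3)\cdots)\cdot u_n)$). Polish Algorithm for left distributivity. Given $(u,v)$, stop if $d(u,v)=\infty$. Otherwise let $d=d(u,v)$. If $v(d)=*$, put $v'=v$ and,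 with the notation above, $$u' = A\,u_0\,u_1 *\, u_0\,u_2 **\, u_0\,u_3 ** \cdots u_0\,u_n **\, B .$$ If $u(d)=*$, put $u'=u$ and define $v'$ analogously with the roles of $u$ and $v$ exchanged. Passing from $(u,v)$ to $(u',v')$ is one step. The algorithm repeats steps; it terminates on $(u,v)$ if after finitely many steps it reaches a pair $(u^*,v^* )$ with $d(u^*,v^* )=\infty$. *)

(* Defs.v *)
From HB Require Import structures.
From mathcomp Require Import all_boot.
From Stdlib Require Import Relation_Operators.

Set Implicit Arguments.
Unset Strict Implicit.
Unset Printing Implicit Defensive.

Inductive letter := X | Star.

Definition letter_eqb (a b : letter) : bool :=
  match a, b with X, X | Star, Star => true | _, _ => false end.

Lemma letter_eqP : Equality.axiom letter_eqb.
Proof. by case; case; constructor. Qed.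

HB.instance Definition _ := hasDecEq.Build letter letter_eqP.

Definition word := seq letter.

(* Right Polish notation: the word s t * is the product of s by t. *)
Inductive is_term : word -> Prop :=
| term_var : is_term [:: X]
| term_mul s t : is_term s -> is_term t -> is_term (s ++ t ++ [:: Star]).

Definition depth (u : word) : nat := count_mem X u.

(* First difference d(u, v), with None standing for infinity; zip truncates
   to the length of the shorter word. *)
Definition first_diff (u v : word) : option nat :=
  let i := find (fun p : letter * letter => p.1 != p.2) (zip u v) in
  if i < minn (size u) (size v) then Some i else None.

(* Given d = d(u, v) with v(d) = *, [expand d u v u'] says that
     u  = A u0 u1 u2 * u3 * ... un * * B,
     v  = A u0 u1 * C,
     u' = A u0 u1 * u0 u2 * * u0 u3 * * ... u0 un * * B,
   where us = [:: u2; ...; un], and u2 starts at position d of u. *)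
Definition expand (d : nat) (u v u' : word) : Prop :=
  exists (A B C u0 u1 : word) (us : seq word),
    [/\ is_term u0, is_term u1, us <> [::] & forall w, w \in us -> is_term w] /\
    [/\ u = A ++ u0 ++ u1 ++ flatten [seq w ++ [:: Star] | w <- us]
              ++ [:: Star] ++ B,
        v = A ++ u0 ++ u1 ++ [:: Star] ++ C,
        size (A ++ u0 ++ u1) = d &
        u' = A ++ u0 ++ u1 ++ [:: Star]
              ++ flatten [seq u0 ++ w ++ [:: Star; Star] | w <- us] ++ B].

(* The default value of nth is irrelevant: d(u, v) is a valid position in
   both words. *)
Inductive step : word * word -> word * word -> Prop :=
| step_left u v u' d :
    first_diff u v = Some d -> nth X v d = Star -> expand d u v u' ->
    step (u, v) (u', v)
| step_right u v v' d :
    first_diff u v = Some d -> nth X u d = Star -> expand d v u v' ->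
    step (u, v) (u, v').

(* The decomposition in [expand] is unique, so that step is deterministic and
   reaching a pair without first difference is the same as halting there. *)
Definition terminates (u v : word) : Prop :=
  exists us vs : word,
    clos_refl_trans_1n (word * word) step (u, v) (us, vs) /\
    first_diff us vs = None.

(* Main.v *)
Require Import Defs.
From HB Require Import structures.
From mathcomp Require Import all_boot.
From Stdlib Require Import Relation_Operators BinPos.
From Stdlib Require FMapPositive.

(** A step of the algorithm never alters the common prefix, so below a common
    prefix ending with a term [s] the two words are described by the lists [L]
    and [M] of the arguments to which [s] is still to be applied.  Comparing
    the heads [t] and [u] of these lists is a recursive call; it ends with a
    common term [r] and leftover arguments [l] or [m] on at most one side, and
    the expansion step turns these into [map (App s) l] or [map (App s) m] in
    front of the remaining arguments of [s r].  Termination for the finitely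
    many pairs is then a computation.  Since some runs produce words of length
    about 10^8, equal large subterms are recognised by labels rather than
    compared letter by letter. *)

Set Implicit Arguments.
Unset Strict Implicit.
Unset Printing Implicit Defensive.

(** * Terms as binary trees, their left spines and their words *)

Inductive tree := Var | App (s t : tree).

Fixpoint wd (t : tree) : word :=
  if t is App s u then wd s ++ wd u ++ [:: Star] else [:: X].

Fixpoint leaves (t : tree) : nat :=
  if t is App s u then leaves s + leaves u else 1.

Fixpoint args_acc (t : tree) (acc : seq tree) : seq tree :=
  if t is App s u then args_acc s (u :: acc) else acc.

(** For [t] equal to x a1 ... an, associated to the left, this is the list of a1, ..., an. *)
Definition args (t : tree) : seq tree := args_acc t [::].

(** Appended to [wd s], this gives the word of [s] applied in turn to the members of [L]. *)
Definition tail (L : seq tree) : word :=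
  flatten [seq wd t ++ [:: Star] | t <- L].

Lemma is_term_wd (w : word) : is_term w -> exists t, wd t = w.
Proof.
elim=> [|s t _ [a <-] _ [b <-]]; first by exists Var.
by exists (App a b).
Qed.

Lemma wd_is_term (t : tree) : is_term (wd t).
Proof. by elim: t => [|s IHs u IHu] /=; constructor. Qed.

Lemma depth_wd (t : tree) : depth (wd t) = leaves t.
Proof.
elim: t => //= s IHs u IHu.
by rewrite -IHs -IHu /depth !count_cat /= !addn0.
Qed.

Lemma leaves_gt0 (t : tree) : 0 < leaves t.
Proof. by elim: t => //= s IHs u _; rewrite addn_gt0 IHs. Qed.

Lemma tail_cat (L M : seq tree) : tail (L ++ M) = tail L ++ tail M.
Proof. by rewrite /tail map_cat flatten_cat. Qed.

Lemma wd_args_acc (t : tree) (acc : seq tree) :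
  wd t ++ tail acc = X :: tail (args_acc t acc).
Proof. by elim: t acc => //= s IHs u _ acc; rewrite -IHs /tail /= !catA. Qed.

Lemma wd_args (t : tree) : wd t = X :: tail (args t).
Proof. by rewrite -wd_args_acc cats0. Qed.

Lemma first_diff_cat (p u v : word) :
  first_diff (p ++ u) (p ++ v) = omap (addn (size p)) (first_diff u v).
Proof.
elim: p => [|c p /= IHp]; first by case: (first_diff u v).
transitivity (omap S (first_diff (p ++ u) (p ++ v))); last first.
  by rewrite IHp; case: (first_diff u v).
by rewrite /first_diff /= eqxx /= minnSS ltnS; case: ifP.
Qed.

Lemma first_diff_prefix (p u : word) :
  first_diff (p ++ u) p = None /\ first_diff p (p ++ u) = None.
Proof.
rewrite -{2 3}[p]cats0 !first_diff_cat.
by case: u => [|c u]; rewrite /first_diff /= ?minn0 ?min0n.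
Qed.

(** * Big-step form of the algorithm *)

(* The algorithm leads from [s] followed by the arguments [L] and [M] to [s']
   followed by [L'] and [M'], whatever letters stand before [s] and after the
   arguments. *)
Inductive cmp : tree -> seq tree -> seq tree ->
                tree -> seq tree -> seq tree -> Prop :=
| cmp_nill s M : cmp s [::] M s [::] M
| cmp_nilr s L : cmp s L [::] s L [::]
| cmp_cons s t L u M r l m s' L' M' :
    cmp Var (args t) (args u) r l m ->
    cmp (App s r) (map (App s) l ++ L) (map (App s) m ++ M) s' L' M' ->
    cmp s (t :: L) (u :: M) s' L' M'.

Lemma cmp_nil (s s' : tree) (L M L' M' : seq tree) :
  cmp s L M s' L' M' -> L' = [::] \/ M' = [::].
Proof. by elim=> *; [left | right |]. Qed.

Lemma cmp_sym (s s' : tree) (L M L' M' : seq tree) :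
  cmp s L M s' L' M' -> cmp s M L s' M' L'.
Proof. by elim=> *; econstructor; eauto. Qed.

(** Justifies both the shortcut of [run] for equal labels and the diagonal case of the theorem. *)
Lemma cmp_refl (t : tree) : cmp Var (args t) (args t) t [::] [::].
Proof.
(* Descending the left spine pushes shared arguments onto [acc]; whatever comparison follows them is
   kept as a continuation. *)
have gen : forall t acc L M s' L' M',
    cmp t (acc ++ L) (acc ++ M) s' L' M' ->
    cmp Var (args_acc t (acc ++ L)) (args_acc t (acc ++ M)) s' L' M'.
  elim=> [|a IHa b IHb] acc L M s' L' M' //= H.
  apply: (IHa (b :: acc)).
  apply: (@cmp_cons _ _ _ _ _ b [::] [::]) H.
  by apply: (IHb [::] [::] [::]); constructor.
by apply: (gen t [::] [::] [::]); constructor.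
Qed.

Local Notation steps := (clos_refl_trans_1n (word * word) step).

Lemma steps_trans (p q r : word * word) : steps p q -> steps q r -> steps p r.
Proof. by elim=> // *; econstructor; eauto. Qed.

Lemma step_sym (u v u' v' : word) :
  step (u, v) (u', v') -> step (v, u) (v', u').
Proof.
have fdC (a b : word) : first_diff a b = first_diff b a.
  elim: a b => [|c a IHa] [|c' b]; rewrite /first_diff ?minn0 ?min0n //=.
  rewrite eq_sym !minnSS; case: eqP => //= _.
  move: (IHa b); rewrite /first_diff !ltnS.
  by case: ifP; case: ifP => // _ _ [->].
move=> H; inversion H; subst.
  by apply: step_right; eauto; rewrite fdC; eauto.
by apply: step_left; eauto; rewrite fdC; eauto.
Qed.

Lemma steps_sym (u v u' v' : word) :
  steps (u, v) (u', v') -> steps (v, u) (v', u').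
Proof.
pose sw (p : word * word) := (p.2, p.1).
suff gen p q : steps p q -> steps (sw p) (sw q) by exact: gen.
elim=> [|[a b] [a' b'] r H _ IH]; first by constructor.
by apply: rt1n_trans IH; apply: step_sym.
Qed.

Lemma tail_map_App (s : tree) (l : seq tree) :
  tail (map (App s) l) =
  flatten [seq wd s ++ w ++ [:: Star; Star] | w <- map wd l].
Proof. by elim: l => //= a l <-; rewrite /tail /= -!catA. Qed.

(** After the common [A ++ wd s ++ wd r], one word goes on with the initial [X] of [t] and the other
    with [Star], so the first difference is exactly there. *)
Lemma step_expand (A B C : word) (s r t : tree) (l : seq tree) :
  step (A ++ wd s ++ wd r ++ tail (t :: l) ++ Star :: B,
        A ++ wd s ++ wd r ++ Star :: C)
       (A ++ wd (App s r) ++ tail (map (App s) (t :: l)) ++ B,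
        A ++ wd s ++ wd r ++ Star :: C).
Proof.
apply: (step_left (d := size (A ++ wd s ++ wd r))).
- have catE D : A ++ wd s ++ wd r ++ D = (A ++ wd s ++ wd r) ++ D.
    by rewrite -!catA.
  rewrite !catE first_diff_cat /tail /= (wd_args t) /=.
  by rewrite /first_diff /= minnSS /= addn0.
- by rewrite !catA nth_cat ltnn subnn.
exists A, B, C, (wd s), (wd r), (map wd (t :: l)); split; first split=> //.
- exact: wd_is_term.
- exact: wd_is_term.
- by move=> w; elim: (t :: l) => //= a m IH; rewrite inE => /orP[/eqP->|/IH];
    [exact: wd_is_term|].
split=> //; first by rewrite /tail -map_comp.
by rewrite tail_map_App [wd (App s r)]/= -[in LHS]catA -[in LHS]catA.
Qed.

Lemma cmp_steps (s s' : tree) (L M L' M' : seq tree) :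
  cmp s L M s' L' M' -> forall A B C,
  steps (A ++ wd s ++ tail L ++ B, A ++ wd s ++ tail M ++ C)
        (A ++ wd s' ++ tail L' ++ B, A ++ wd s' ++ tail M' ++ C).
Proof.
elim=> {s s' L M L' M'} [s M|s L|s t L u M r l m s' L' M' H1 IH1 _ IH2] A B C;
  try exact: rt1n_refl.
have tail_cons a K D : tail (a :: K) ++ D = wd a ++ Star :: tail K ++ D.
  by rewrite /tail /= -!catA.
(* The pair reached once the heads [t] and [u] have been compared behind the prefix [A ++ wd s]. *)
apply: (@steps_trans _
  (A ++ wd s ++ wd r ++ tail l ++ Star :: tail L ++ B,
   A ++ wd s ++ wd r ++ tail m ++ Star :: tail M ++ C)).
  rewrite !tail_cons (wd_args t) (wd_args u).
  by move: (IH1 (A ++ wd s) (Star :: tail L ++ B) (Star :: tail M ++ C));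
    rewrite /= -!catA.
apply: steps_trans (IH2 A B C); rewrite !tail_cat -!(catA (tail _)).
have joinE D : A ++ wd s ++ wd r ++ Star :: D = A ++ wd (App s r) ++ D.
  by rewrite /= -!catA.
(* A nonempty list of leftovers is distributed in a single step; an empty one needs none. *)
have step1 l0 B0 C0 : steps
    (A ++ wd s ++ wd r ++ tail l0 ++ Star :: B0, A ++ wd (App s r) ++ C0)
    (A ++ wd (App s r) ++ tail (map (App s) l0) ++ B0, A ++ wd (App s r) ++ C0).
  case: l0 => [|a l0].
    by rewrite [tail _ ++ _]/= joinE; exact: rt1n_refl.
  rewrite -(joinE C0).
  apply: rt1n_trans (step_expand _ _ _ _ _ _ _) _.
  by constructor.
case: (cmp_nil H1) => ?; subst.
  by rewrite [tail [::] ++ _]/= joinE; apply: steps_sym; exact: step1.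
by rewrite [tail [::] ++ _]/= joinE; exact: step1.
Qed.

Lemma cmp_terminates (t u s' : tree) (L' M' : seq tree) :
  cmp Var (args t) (args u) s' L' M' -> terminates (wd t) (wd u).
Proof.
move=> H; exists (wd s' ++ tail L'), (wd s' ++ tail M'); split.
  by have := cmp_steps H [::] [::] [::]; rewrite /= !cats0 -!wd_args.
case: (cmp_nil H) => ->; rewrite (_ : tail [::] = [::]) // cats0.
  by case: (first_diff_prefix (wd s') (tail M')).
by case: (first_diff_prefix (wd s') (tail L')).
Qed.

(** * Labelled trees *)

Module PM := FMapPositive.PositiveMap.

Inductive dag := Leaf | Node (lbl : option positive) (a b : dag).

Definition dag_eq_dec (a b : dag) : {a = b} + {a <> b}.
Proof. by do 3!decide equality. Defined.

HB.instance Definition _ := hasDecEq.Build dag (compareP dag_eq_dec).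

Fixpoint den (a : dag) : tree :=
  if a is Node _ b c then App (den b) (den c) else Var.

Definition label (a : dag) : option positive :=
  if a is Node k _ _ then k else Some xH.

(* The [k]-th pair [(i, j)], counted from 0, gives the label [k + 2] to the
   product of the trees labelled [i] and [j]; the variable has label 1.  These
   are the subterms of the large terms that get compared
   with themselves in the two runs that need labels: those of x(xxxx(x(xx)))
   against xxxxx(x(xx)) and against xxxx(x(x(xx))). *)
Definition labels : seq (positive * positive) :=
  [:: (1, 1); (2, 1); (3, 1); (4, 1); (4, 4); (5, 5); (6, 4); (8, 1); (8, 2);
   (7, 5); (10, 1); (10, 2); (11, 5); (14, 4); (15, 1); (15, 2); (17, 1);
   (17, 2); (13, 12); (20, 12); (19, 18); (22, 18); (21, 21); (23, 18);
   (24, 21); (26, 12); (27, 1); (27, 2); (27, 9); (25, 25); (31, 25); (30, 30);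
   (32, 25); (33, 28); (33, 29); (34, 23); (37, 18); (38, 16); (39, 1);
   (39, 2); (39, 16); (36, 35); (42, 42); (43, 35); (44, 40); (44, 41);
   (45, 45); (47, 46); (48, 45); (50, 35); (51, 27); (52, 1); (52, 2); (52, 9);
   (52, 12); (52, 20); (49, 46); (58, 46); (57, 56); (59, 59); (60, 60);
   (61, 59); (63, 59); (62, 60); (64, 58); (66, 46); (65, 56); (67, 42);
   (69, 1); (69, 2); (69, 16); (68, 53); (68, 54); (68, 55); (75, 75);
   (76, 73); (76, 74); (78, 77); (79, 77); (80, 80); (81, 80); (82, 77);
   (83, 53); (83, 55)]%positive.

Fixpoint index_from (k : positive) (s : seq (positive * positive)) :
    PM.t (PM.t positive) * PM.t (positive * positive) :=
  if s is (i, j) :: s' then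
    let: (hint, inv) := index_from (Pos.succ k) s' in
    (PM.add i (PM.add j k (odflt (PM.empty _) (PM.find i hint))) hint,
     PM.add k (i, j) inv)
  else (PM.empty _, PM.empty _).

Definition hint := (index_from 2 labels).1.
Definition inv := (index_from 2 labels).2.

(* Rereading [inv] makes a label determine its pair whatever the tables are. *)
Definition lookup (i j : positive) : option positive :=
  if PM.find i hint is Some h then
    if PM.find j h is Some k then
      if PM.find k inv is Some (i', j') then
        if Pos.eqb i i' then
          if Pos.eqb j j' then Some k else None
        else None
      else None
    else None
  else None.

Definition app (a b : dag) : dag :=
  Node (if label a is Some i then
          if label b is Some j then lookup i j else None
        else None) a b.

Fixpoint well_labelled (a : dag) : Prop :=
  if a is Node lbl b c then
    [/\ well_labelled b, well_labelled c & forall k, lbl = Some k ->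
        exists i j, [/\ label b = Some i, label c = Some j &
                        PM.find k inv = Some (i, j)]]
  else True.

Lemma lookup_inv (i j k : positive) :
  lookup i j = Some k -> PM.find k inv = Some (i, j).
Proof.
rewrite /lookup; case: (PM.find i hint) => // h; case: (PM.find j h) => // k'.
case E: (PM.find k' inv) => [[i' j']|] //.
case: Pos.eqb_spec => // ->; case: Pos.eqb_spec => // ->.
by case=> <-.
Qed.

Lemma app_wl (a b : dag) :
  well_labelled a -> well_labelled b -> well_labelled (app a b).
Proof.
move=> wa wb; split=> // k.
by case: (label a) => // i; case: (label b) => // j /lookup_inv; exists i, j.
Qed.

(** By induction on both trees: through [inv], the label of a product determines the labels of its
    two factors. *)
Lemma label_inj (a b : dag) (k : positive) :
  well_labelled a -> well_labelled b ->
  label a = Some k -> label b = Some k -> a = b.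
Proof.
(* Labels of products start at 2, so none of them coincides with the label 1 of [Leaf]. *)
have inv1 : PM.find xH inv = None by vm_compute.
elim: a b k => [|la a1 IH1 a2 IH2] [|lb b1 b2] k //=.
- by move=> _ [_ _ H] [<-] /H [i [j [_ _]]]; rewrite inv1.
- by move=> [_ _ H] _ /H [i [j [_ _ E]]] [ek]; move: E; rewrite -ek inv1.
move=> [wa1 wa2 Ha] [wb1 wb2 Hb] ea eb.
have [i [j [la1 la2 E]]] := Ha _ ea; have [i' [j' [lb1 lb2]]] := Hb _ eb.
rewrite E => -[ei ej]; subst i' j'.
by rewrite (IH1 _ _ wa1 wb1 la1 lb1) (IH2 _ _ wa2 wb2 la2 lb2) ea eb.
Qed.

Definition same_label (a b : dag) : bool :=
  if label a is Some i then
    if label b is Some j then Pos.eqb i j else false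
  else false.

Lemma same_labelP (a b : dag) :
  well_labelled a -> well_labelled b -> same_label a b -> a = b.
Proof.
rewrite /same_label => wa wb.
case ea: (label a) => [i|] //; case eb: (label b) => [j|] //.
by case: Pos.eqb_spec => // ij _; apply: label_inj ea _; rewrite ?eb ?ij.
Qed.

(** * Evaluation of [cmp] on labelled trees *)

Fixpoint dargs_acc (a : dag) (acc : seq dag) : seq dag :=
  if a is Node _ b c then dargs_acc b (c :: acc) else acc.

Definition dargs (a : dag) : seq dag := dargs_acc a [::].

Definition wls (L : seq dag) : Prop :=
  foldr (fun a P => well_labelled a /\ P) True L.

Lemma wls_cat (L M : seq dag) : wls L -> wls M -> wls (L ++ M).
Proof. by elim: L => //= a L IH [wa wL] wM; split; auto. Qed.

Lemma wls_app (s : dag) (L : seq dag) :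
  well_labelled s -> wls L -> wls (map (app s) L).
Proof.
by move=> ws; elim: L => //= a L IH [wa wL]; split; auto; apply: app_wl.
Qed.

Lemma wls_dargs (a : dag) : well_labelled a -> wls (dargs a).
Proof.
rewrite /dargs; have : wls [::] by [].
by elim: a [::] => //= l b IHb c _ acc wacc [wb wc _]; apply: IHb.
Qed.

Lemma den_dargs (a : dag) : map den (dargs a) = args (den a).
Proof.
rewrite /dargs /args -[RHS]/(args_acc (den a) (map den [::])).
by elim: a [::] => //= l b IHb c _ acc; rewrite IHb.
Qed.

Lemma den_app (s : dag) (L M : seq dag) :
  map den (map (app s) L ++ M) = map (App (den s)) (map den L) ++ map den M.
Proof. by rewrite map_cat -!map_comp. Qed.

(** All recursive calls receive [n'], so the fuel bounds the depth of the recursion and not the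
    number of calls; [None] means that it ran out. *)
Fixpoint run (n : nat) (s : dag) (L M : seq dag) :
    option (dag * seq dag * seq dag) :=
  if n is n'.+1 then
    match L, M with
    | a :: L', b :: M' =>
      if same_label a b then run n' (app s a) L' M' else
      if run n' Leaf (dargs a) (dargs b) is Some (r, l, m) then
        run n' (app s r) (map (app s) l ++ L') (map (app s) m ++ M')
      else None
    | _, _ => Some (s, L, M)
    end
  else None.

Lemma run_cmp (n : nat) (s s' : dag) (L M L' M' : seq dag) :
  well_labelled s -> wls L -> wls M -> run n s L M = Some (s', L', M') ->
  [/\ well_labelled s', wls L', wls M' &
      cmp (den s) (map den L) (map den M) (den s') (map den L') (map den M')].
Proof.
elim: n s s' L M L' M' => //= n IHn s s' [|a L] M L' M' ws.
  by move=> _ wM [<- <- <-]; split=> //; constructor.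
case: M => [|b M]; first by move=> wL _ [<- <- <-]; split=> //; constructor.
move=> [wa wL] [wb wM]; case: ifP => [ab|_].
  case/(IHn _ _ _ _ _ _ (app_wl ws wa) wL wM) => ? ? ? H; split=> //.
  rewrite -(same_labelP wa wb ab) /=.
  by apply: (@cmp_cons _ _ _ _ _ _ [::] [::] _ _ _ (cmp_refl _)).
case E: (run _ _ _ _) => [[[r l] m]|] //.
have [||| wr wll wm H1] := IHn _ _ _ _ _ _ _ _ _ E => //.
- exact: wls_dargs.
- exact: wls_dargs.
case/IHn; try by [apply: app_wl | apply: wls_cat => //; apply: wls_app].
move=> ? ? ?; rewrite !den_app => H2; split=> //=.
by apply: cmp_cons H2; rewrite -!den_dargs.
Qed.

(** * Enumeration *)

Fixpoint lab (t : tree) : dag :=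
  if t is App s u then app (lab s) (lab u) else Leaf.

Lemma lab_wl (t : tree) : well_labelled (lab t).
Proof. by elim: t => //= s IHs u IHu; apply: app_wl. Qed.

Lemma den_lab (t : tree) : den (lab t) = t.
Proof. by elim: t => //= s -> u ->. Qed.

(* [f] is fuel: [f >= n] is needed to get all terms of depth [n]. *)
Fixpoint terms (f n : nat) : seq dag :=
  if f is f'.+1 then
    if n == 1 then [:: Leaf] else
    flatten [seq [seq app a b | a <- terms f' i, b <- terms f' (n - i)]
            | i <- iota 1 n.-1]
  else [::].

Lemma mem_terms (f : nat) (t : tree) :
  leaves t <= f -> lab t \in terms f (leaves t).
Proof.
elim: f t => [|f IHf] t; first by rewrite leqNgt leaves_gt0.
case: t => [|s u] //= le_f.
have s0 := leaves_gt0 s; have u0 := leaves_gt0 u.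
rewrite gtn_eqF ?(leq_add s0 u0) //.
apply/flattenP; exists [seq app a b | a <- terms f (leaves s),
    b <- terms f (leaves s + leaves u - leaves s)].
  apply/mapP; exists (leaves s) => //.
  by rewrite mem_iota s0 add1n prednK ?addn_gt0 ?s0 // -addn1 leq_add.
apply: allpairs_f.
  by apply: IHf; rewrite -ltnS (leq_trans _ le_f) // -addn1 leq_add.
by rewrite addKn; apply: IHf; rewrite -ltnS (leq_trans _ le_f) // -add1n leq_add.
Qed.

(** That a fuel of 400 suffices is confirmed by the computation in [chk_terms8]. *)
Definition chk (a b : dag) : bool := run 400 Leaf (dargs a) (dargs b) != None.

Definition terms8 : seq dag := flatten [seq terms 8 n | n <- iota 1 8].

(** Only pairs in list order are run: [cmp_sym] supplies the reverse order and [cmp_refl] the equal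
    pairs. *)
Lemma chk_terms8 : pairwise chk terms8.
Proof. by vm_cast_no_check (erefl true). Qed.

Lemma mem_terms8 (t : tree) : leaves t <= 8 -> lab t \in terms8.
Proof.
move=> t8; apply/flattenP; exists (terms 8 (leaves t)); last exact: mem_terms.
by apply: map_f; rewrite mem_iota leaves_gt0.
Qed.

Lemma chk_cmp (t u : tree) :
  chk (lab t) (lab u) ->
  exists s' L' M', cmp Var (args t) (args u) s' L' M'.
Proof.
rewrite /chk; case E: run => [[[s' L'] M']|] // _.
have [||| _ _ _] := run_cmp _ _ _ E => //; try exact/wls_dargs/lab_wl.
by rewrite !den_dargs !den_lab => H; exists (den s'), (map den L'), (map den M').
Qed.

Lemma pairwise_mem (T : eqType) (r : rel T) (s : seq T) (a b : T) :
  pairwise r s -> a \in s -> b \in s -> [\/ a = b, r a b | r b a].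
Proof.
elim: s => //= c s IHs /andP[/allP rc rs]; rewrite !inE.
case/predU1P=> [->|sa] /predU1P[->|sb]; last exact: IHs.
- by constructor 1.
- by constructor 2; apply: rc.
- by constructor 3; apply: rc.
Qed.

Theorem theorem4p1 (u v : word) :
  is_term u -> is_term v -> depth u <= 8 -> depth v <= 8 -> terminates u v.
Proof.
move=> /is_term_wd [t <-] /is_term_wd [t' <-].
rewrite !depth_wd => /mem_terms8 tin /mem_terms8 tin'.
have [e|/chk_cmp [s' [L' [M' H]]]|/chk_cmp [s' [L' [M' H]]]] :=
  pairwise_mem chk_terms8 tin tin'.
- by rewrite -(den_lab t) e den_lab; apply: cmp_terminates (cmp_refl t').
- exact: cmp_terminates H.
- exact: cmp_terminates (cmp_sym H).
Qed.
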